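(* Let $L_\alpha:\mathsf{Nom}\to\mathsf{Nom}$ be the functor $L_\alpha X=\mathcal V+[\mathcal V]X+X\times X$. The rational fixpoint $\varrho L_\alpha$, regarded as a subcoalgebra of the final coalgebra $\nu L_\alpha$ (whose elements are the $\lambda$-trees with finitely many free variables modulo $\alpha$-equivalence), contains precisely the rational $\lambda$-trees modulo $\alpha$-equivalence; that is, an element of $\nu L_\alpha$ lies in $\varrho L_\alpha$ if and only if it is the $\alpha$-equivalence class of some rational $\lambda$-tree (and every $\alpha$-equivalence class of a rational $\lambda$-tree is an element of $\varrho L_\alpha$).
   Context: Fix a countably infinite set $\mathcal V$ of variables, and let $\mathfrak S(\mathcal V)$ be the group of finite permutations of $\mathcal V$ (those $\pi$ with $\{v\mid \pi(v)\neq v\}$ finite). Nominal sets. For a set $X$ with an action of $\mathfrak S(\mathcal V)$, a set $S\subseteq\mathcal V$ supports $x\in X$ if $\pi\cdot x=x$ for every $\pi$ fixing $S$ pointwise. $X$ is a nominal set if every element has a finite support; then $\mathrm{supp}(x)$ is the least finite set supporting $x$, and $v\mathbin{\#}x$ ($v$ is fresh for $x$) means $v\notin\mathrm{supp}(x)$. $\mathsf{Nom}$ is the category of nominal sets and equivariant maps. The set $\mathcal V$ is nominal with $\pi\cdot v=\pi(v)$. A nominal set is orbit-finite if it has finitely many orbits; the orbit-finite nominal sets are the finitely presentable objects of $\mathsf{Nom}$. Abstraction. For a nominal set $X$, put $(v_1,x_1)\sim_\alpha(v_2,x_2)$ on $\mathcal V\times X$ if there is $z\notin\{v_1,v_2\}$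 with $z\mathbin{\#}x_1$, $z\mathbin{\#}x_2$ and $(v_1\ z)\cdot x_1=(v_2\ z)\cdot x_2$. The class of $(v,x)$ is written $\langle v\rangle x$, and $[\mathcal V]X=(\mathcal V\times X)/{\sim_\alpha}$ with $\pi\cdot\langle v\rangle x=\langle\pi(v)\rangle(\pi\cdot x)$; on equivariant maps, $[\mathcal V]f(\langle v\rangle x)=\langle v\rangle f(x)$. $\lambda$-trees. A $\lambda$-tree is a finite or infinite rooted ordered tree with leaves labelled by variables in $\mathcal V$ and inner nodes of two sorts: nodes with one successor labelled $\lambda x$ for some $x\in\mathcal V$, and nodes with two successors labelled $@$. Free and bound variables are as usual ($\lambda x$ binds $x$ in the subtree below it). Two $\lambda$-trees are $\alpha$-equivalent if for every $n$ their truncations at level $n$ (cut-off subtrees being replaced by a fixed constant leaf) are $\alpha$-equivalent finite $\lambda$-terms. A $\lambda$-tree is rational if it has only finitely many subtrees up to isomorphism (of labelled ordered trees). A $\lambda$-tree modulo $\alpha$-equivalence, i.e. an $\alpha$-equivalence class of $\lambda$-trees, is rational if it contains at least one rational $\lambda$-tree. Final coalgebra. The final $L_\alpha$-coalgebra $\nu L_\alpha$ is the set of all $\lambda$-trees with finitely many free variables modulo $\alpha$-equivalence, with action induced by applying $\pi$ to all variables occurring in labels, and structure decomposing at the root: $[x]_\alpha\mapsto x$, $[\lambda x.t]_\alpha\mapsto\langle x\rangle[t]_\alpha$, and $[t\,s]_\alpha\mapsto([t]_\alpha,[s]_\alpha)$, where $t\,s$ is the tree with root $@$ and successors $t,s$.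 Rational fixpoint. $\varrho L_\alpha$ is the colimit in the category of $L_\alpha$-coalgebras of the inclusion of the full subcategory of coalgebras with orbit-finite carrier. It is identified with the subcoalgebra of $\nu L_\alpha$ given by $\varrho L_\alpha=\bigcup_{(C,c)}c^\dagger[C]$, where $(C,c)$ ranges over all $L_\alpha$-coalgebras with orbit-finite carrier and $c^\dagger:(C,c)\to\nu L_\alpha$ is the unique coalgebra homomorphism. *)

(* Defs.v *)
From HB Require Import structures.
From mathcomp Require Import all_boot.
From mathcomp Require Import boolp classical_sets functions cardinality.

Set Implicit Arguments.
Unset Strict Implicit.
Unset Printing Implicit Defensive.

Local Open Scope classical_set_scope.
Local Open Scope quotient_scope.
Local Open Scope group_scope.

Record varType := VarType {
  var_sort :> countType;
  var_infinite : infinite_set [set: var_sort] }.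

Lemma fresh_var (V : varType) (S : set V) : finite_set S -> exists v, ~ S v.
Proof.
move=> fS; apply: contrapT => nS; apply: (@var_infinite V).
apply: sub_finite_set fS => v _; apply: contrapT => nSv.
by apply: nS; exists v.
Qed.

Record fperm (V : varType) := FPerm {
  fperm_fun :> V -> V;
  fperm_bij : bijective fperm_fun;
  fperm_fin : finite_set [set v | fperm_fun v <> v] }.

HB.instance Definition _ (V : varType) := gen_eqMixin (fperm V).
HB.instance Definition _ (V : varType) := gen_choiceMixin (fperm V).

Section FPermGroup.
Context {V : varType}.
Implicit Types p q r : fperm V.

Lemma fperm_ext p q : p =1 q -> p = q.
Proof.
case: p q => [f bf ff] [g bg fg] /= /funext fg_eq.
by case: _ / fg_eq bg fg => bg fg; congr FPerm; apply: Prop_irrelevance.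
Qed.

Definition fperm_one : fperm V.
Proof.
exists id; first by exists id.
by rewrite (_ : [set v | _] = set0) //; apply/seteqP; split=> v.
Defined.

Definition fperm_mul p q : fperm V.
Proof.
exists (p \o q); first by apply: bij_comp; apply: fperm_bij.
have : finite_set ([set v | q v <> v] `|` [set v | p v <> v]).
  by rewrite finite_setU; split; apply: fperm_fin.
apply: sub_finite_set => v /= pqv.
by case: (pselect (q v = v)) pqv => [->|]; [right|left].
Defined.

Lemma fperm_surj p v : exists w, p w = v.
Proof. by case: (fperm_bij p) => g _ gK; exists (g v). Qed.

Definition fperm_inv_fun p v := sval (cid (fperm_surj p v)).

Lemma fperm_inv_funK p : cancel (fperm_inv_fun p) p.
Proof. by move=> v; apply: (svalP (cid (fperm_surj p v))). Qed.
Lemma fperm_funK p : cancel p (fperm_inv_fun p).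
Proof. by move=> v; apply: (bij_inj (fperm_bij p)); rewrite fperm_inv_funK. Qed.

Definition fperm_inv p : fperm V.
Proof.
exists (fperm_inv_fun p); first by exists p; [exact: fperm_inv_funK|exact: fperm_funK].
apply: sub_finite_set (fperm_fin p) => v /= gv pv; apply: gv.
by rewrite -{1}pv fperm_funK.
Defined.

Lemma fperm_mulA : associative fperm_mul.
Proof. by move=> p q r; apply: fperm_ext. Qed.
Lemma fperm_mul1p : left_id fperm_one fperm_mul.
Proof. by move=> p; apply: fperm_ext. Qed.
Lemma fperm_mulp1 : right_id fperm_one fperm_mul.
Proof. by move=> p; apply: fperm_ext. Qed.
Lemma fperm_mulpV : right_inverse fperm_one fperm_inv fperm_mul.
Proof. by move=> p; apply: fperm_ext; apply: fperm_inv_funK. Qed.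
Lemma fperm_mulVp : left_inverse fperm_one fperm_inv fperm_mul.
Proof. by move=> p; apply: fperm_ext; apply: fperm_funK. Qed.

HB.instance Definition _ := isGroup.Build (fperm V)
  fperm_mulA fperm_mul1p fperm_mulp1 fperm_mulVp fperm_mulpV.

Lemma fperm1E v : (1 : fperm V) v = v. Proof. by []. Qed.
Lemma fpermME p q v : (p * q) v = p (q v). Proof. by []. Qed.
Lemma fpermVK p v : p^-1 (p v) = v.
Proof. by rewrite -fpermME mulVg. Qed.
Lemma fpermKV p v : p (p^-1 v) = v.
Proof. by rewrite -fpermME mulgV. Qed.
Lemma fperm_inj p : injective p.
Proof. exact: bij_inj (fperm_bij p). Qed.

Definition swap_fun (x y v : V) := if v == x then y else if v == y then x else v.

Lemma swap_funK x y : involutive (swap_fun x y).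
Proof.
move=> v; rewrite /swap_fun; case: (v =P x) => [->|nx].
  by rewrite eqxx; case: (y =P x).
case: (v =P y) => [->|ny]; first by rewrite eqxx.
by case: (v =P x) => // _; case: (v =P y).
Qed.

Definition swap (x y : V) : fperm V.
Proof.
exists (swap_fun x y); first by exists (swap_fun x y); exact: swap_funK.
apply: sub_finite_set (finite_set2 x y) => v /=; rewrite /swap_fun.
by case: (eqVneq v x) => [|_]; [left|case: (eqVneq v y) => // ->; right].
Defined.

Lemma swapE x y v : swap x y v = if v == x then y else if v == y then x else v.
Proof. by []. Qed.
Lemma swapL x y : swap x y x = y. Proof. by rewrite swapE eqxx. Qed.
Lemma swapR x y : swap x y y = x.
Proof. by rewrite swapE eqxx; case: eqP. Qed.
Lemma swapD x y v : v <> x -> v <> y -> swap x y v = v.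
Proof. by move=> /eqP/negPf nx /eqP/negPf ny; rewrite swapE nx ny. Qed.

Lemma swap_conj p x y : p * swap x y = swap (p x) (p y) * p.
Proof.
apply: fperm_ext => v; rewrite !fpermME.
case: (pselect (v = x)) => [->|nx]; first by rewrite !swapL.
case: (pselect (v = y)) => [->|ny]; first by rewrite !swapR.
by rewrite !swapD // => /fperm_inj.
Qed.

End FPermGroup.

Definition supports_of (V : varType) (X : Type) (act : fperm V -> X -> X)
    (S : set V) (x : X) :=
  forall p : fperm V, (forall v, S v -> p v = v) -> act p x = x.

Record nomSet (V : varType) := NomSet {
  nom_sort :> Type;
  act : fperm V -> nom_sort -> nom_sort;
  act1 : forall x, act 1 x = x;
  actM : forall p q x, act (p * q) x = act p (act q x);
  act_fin : forall x, exists2 S, finite_set S & supports_of act S x }.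

Section NomTheory.
Context {V : varType}.
Implicit Types (X Y : nomSet V) (p q : fperm V) (S : set V).

Definition supports X S (x : X) := supports_of (@act V X) S x.

(* The least finite supporting set, see [supp_least]. *)
Definition supp X (x : X) : set V :=
  \bigcap_(S in [set S | finite_set S /\ supports S x]) S.

Definition fresh X (v : V) (x : X) := ~ supp x v.

Lemma freshP X v (x : X) :
  fresh v x <-> exists S, [/\ finite_set S, supports S x & ~ S v].
Proof.
split=> [nv|[S [fS sS nS]] /(_ S)]; last by apply/not_implyP.
apply: contrapT => h; apply: nv => S [fS sS]; apply: contrapT => nS.
by apply: h; exists S.
Qed.

Lemma actK X p : cancel (@act V X p) (act p^-1).
Proof. by move=> x; rewrite -actM mulVg act1. Qed.
Lemma actKV X p : cancel (@act V X p^-1) (act p).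
Proof. by move=> x; rewrite -actM mulgV act1. Qed.
Lemma act_inj X p : injective (@act V X p).
Proof. exact: can_inj (@actK X p). Qed.

Lemma supports_eq X S (x : X) p q : supports S x ->
  (forall v, S v -> p v = q v) -> act p x = act q x.
Proof.
move=> sS pq; apply: (@act_inj _ q^-1); rewrite actK -actM.
by apply: sS => v Sv; rewrite fpermME pq // fpermVK.
Qed.

Lemma supportsS X S S' (x : X) : S `<=` S' -> supports S x -> supports S' x.
Proof. by move=> SS' sS p fp; apply: sS => v /SS'; apply: fp. Qed.

Lemma supports_act X S (x : X) p : supports S x -> supports (p @` S) (act p x).
Proof.
move=> sS q fq; rewrite -actM; apply: (supports_eq sS) => v Sv.
by rewrite fpermME fq //; exists v.
Qed.

Record nomHom X Y := NomHom {
  nom_fun :> X -> Y;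
  nom_funJ : forall p x, nom_fun (act p x) = act p (nom_fun x) }.

Lemma nomHom_ext X Y (f g : nomHom X Y) : f =1 g -> f = g.
Proof.
case: f g => [f fJ] [g gJ] /= /funext fg.
by case: _ / fg gJ => gJ; congr NomHom; apply: Prop_irrelevance.
Qed.

Lemma hom_supports X Y (f : nomHom X Y) S x : supports S x -> supports S (f x).
Proof. by move=> sS p fp; rewrite -[in LHS]nom_funJ sS. Qed.

Lemma supports_fresh X S v (x : X) : finite_set S -> supports S x ->
  fresh v x -> supports (S `\ v) x.
Proof.
move=> fS sS /freshP[T [fT sT nTv]] p fp.
have [w nw] : exists w, ~ ([set u | p u <> u] `|` (v |` (S `|` T))) w.
  by apply: fresh_var; rewrite !finite_setU; split; [exact: fperm_fin|].
have xE : act (swap v w) x = x.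
  apply: sT => u Tu; apply: swapD => e; first by apply: nTv; rewrite -e.
  by apply: nw; right; right; right; rewrite -e.
have := supports_act (p := swap v w) sS; rewrite xE; apply=> _ [u Su <-].
case: (pselect (u = v)) => [->|uv].
  by rewrite swapL; apply: contrapT => pw; apply: nw; left.
rewrite swapD //; first by apply: fp; split.
by move=> e; apply: nw; right; right; left; rewrite -e.
Qed.

Lemma supp_least X (x : X) : [/\ finite_set (supp x), supports (supp x) x &
  forall S, finite_set S -> supports S x -> supp x `<=` S].
Proof.
have le S : finite_set S -> supports S x -> supp x `<=` S.
  by move=> fS sS v; apply.
case: (act_fin x) => S fS sS; split=> //; first exact: sub_finite_set (le S fS sS) fS.
have /finite_seqP[l lE] : finite_set (S `\` supp x).
  by apply: sub_finite_set fS => v [].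
have lf : forall v, v \in l -> fresh v x.
  by move=> v vl; have : [set` l] v by []; rewrite -lE => -[].
have [R fR [sR RE]] : exists2 R, finite_set R & supports R x /\
    R `<=` S `\` [set` l].
  elim: l lf {lE} => [|v l IH] lf.
    by exists S => //; split=> // v Sv; split.
  have [u ul|R fR [sR RE]] := IH; first by apply: lf; rewrite inE ul orbT.
  exists (R `\ v); first by apply: sub_finite_set fR => u [].
  split; first by apply: supports_fresh => //; apply: lf; rewrite inE eqxx.
  move=> u [/RE[Su nu] uv]; split=> //=; rewrite inE => /orP[/eqP//|].
  exact: nu.
apply: supportsS sR => v /RE[Sv nl]; apply: contrapT => nv; apply: nl.
by rewrite -lE.
Qed.

Definition orbit X (x : X) : set X := [set act p x | p in [set: fperm V]].

Definition orbit_finite X := finite_set (range (@orbit X)).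

Definition nom_var : nomSet V.
Proof.
refine (@NomSet V V (fun p v => p v) _ _ _) => // v.
by exists [set v] => // p; apply.
Defined.

Definition sum_map (A B C D : Type) (f : A -> C) (g : B -> D) (u : A + B) :=
  match u with inl a => inl (f a) | inr b => inr (g b) end.

Definition nom_sum X Y : nomSet V.
Proof.
refine (@NomSet V (X + Y)%type (fun p => sum_map (act p) (act p)) _ _ _).
- by move=> [x|y] /=; rewrite act1.
- by move=> p q [x|y] /=; rewrite actM.
move=> [x|y]; [case: (act_fin x)|case: (act_fin y)] => S fS sS;
  by exists S => // p fp /=; rewrite sS.
Defined.

Definition nom_prod X Y : nomSet V.
Proof.
refine (@NomSet V (X * Y)%type (fun p u => (act p u.1, act p u.2)) _ _ _).
- by move=> [x y] /=; rewrite !act1.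
- by move=> p q [x y] /=; rewrite !actM.
move=> [x y]; case: (act_fin x) => S fS sS; case: (act_fin y) => T fT sT.
exists (S `|` T); first by rewrite finite_setU.
by move=> p fp /=; rewrite sS ?sT // => v ?; apply: fp; [right|left].
Defined.

Definition abs_rel X (a b : V * X) : Prop :=
  exists z, [/\ z <> a.1 /\ z <> b.1, fresh z a.2, fresh z b.2 &
    act (swap a.1 z) a.2 = act (swap b.1 z) b.2].

Lemma abs_rel_any X (a b : V * X) : abs_rel a b ->
  exists2 S, finite_set S &
    forall z, ~ S z -> act (swap a.1 z) a.2 = act (swap b.1 z) b.2.
Proof.
case: a b => [v x] [w y] [z /= [[zv zw]]].
move=> /freshP[S [fS sS nS]] /freshP[T [fT sT nT]] e.
exists ([set v; w; z] `|` (S `|` T)).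
  by rewrite !finite_setU; split=> //; split=> //.
move=> u nu.
have uv : u <> v by move=> ?; apply: nu; left; left; left.
have uw : u <> w by move=> ?; apply: nu; left; left; right.
have uz : u <> z by move=> ?; apply: nu; left; right.
have nSu : ~ S u by move=> ?; apply: nu; right; left.
have nTu : ~ T u by move=> ?; apply: nu; right; right.
have aux c (R : set V) (t : X) : z <> c -> u <> c -> ~ R z -> ~ R u ->
    supports R t -> act (swap c u) t = act (swap z u) (act (swap c z) t).
  move=> zc uc nRz nRu sR; rewrite -actM; apply: (supports_eq sR) => r Rr.
  rewrite fpermME; case: (pselect (r = c)) => [->|rc]; first by rewrite !swapL.
  have rz : r <> z by move=> rz; apply: nRz; rewrite -rz.
  have ru : r <> u by move=> ru; apply: nRu; rewrite -ru.
  by rewrite !(swapD rc, swapD rz).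
by rewrite (aux v S) // e (aux w T).
Qed.

Lemma abs_rel_some X (a b : V * X) (S : set V) : finite_set S ->
  (forall z, ~ S z -> act (swap a.1 z) a.2 = act (swap b.1 z) b.2) ->
  abs_rel a b.
Proof.
move=> fS h; case: (act_fin a.2) => A fA sA; case: (act_fin b.2) => B fB sB.
have [z nz] : exists z, ~ (S `|` [set a.1; b.1] `|` (A `|` B)) z.
  by apply: fresh_var; rewrite !finite_setU; split=> //; split=> //.
exists z; split.
- by split=> e; apply: nz; left; right; [left|right].
- by apply/freshP; exists A; split=> // ?; apply: nz; right; left.
- by apply/freshP; exists B; split=> // ?; apply: nz; right; right.
- by apply: h => ?; apply: nz; left; left.
Qed.

Lemma abs_rel_refl X (a : V * X) : abs_rel a a.
Proof. exact: (@abs_rel_some _ _ _ set0). Qed.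

Lemma abs_rel_sym X (a b : V * X) : abs_rel a b -> abs_rel b a.
Proof. by case=> z [[? ?] ? ? ?]; exists z; split. Qed.

Lemma abs_rel_trans X (a b c : V * X) : abs_rel a b -> abs_rel b c -> abs_rel a c.
Proof.
move=> /abs_rel_any[S fS hS] /abs_rel_any[T fT hT].
apply: (@abs_rel_some _ _ _ (S `|` T)); first by rewrite finite_setU.
by move=> z nz; rewrite hS ?hT // => ?; apply: nz; [right|left].
Qed.

Lemma abs_rel_act X p (v w : V) (x y : X) : abs_rel (v, x) (w, y) ->
  abs_rel (p v, act p x) (p w, act p y).
Proof.
move=> /abs_rel_any[S fS hS]; apply: (@abs_rel_some _ _ _ (p @` S)).
  exact: finite_image.
move=> z nz /=; rewrite -(fpermKV p z) -!actM -!swap_conj !actM.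
by rewrite (hS (p^-1 z)) // => Sz; apply: nz; exists (p^-1 z); rewrite ?fpermKV.
Qed.

Definition abs_eqb X : rel {classic (V * X)} := fun a b => `[< abs_rel a b >].

Lemma abs_eqb_refl X : reflexive (@abs_eqb X).
Proof. by move=> a; apply/asboolP/abs_rel_refl. Qed.
Lemma abs_eqb_sym X : symmetric (@abs_eqb X).
Proof. by move=> a b; apply/asboolP/asboolP; apply: abs_rel_sym. Qed.
Lemma abs_eqb_trans X : transitive (@abs_eqb X).
Proof.
by move=> a b c /asboolP ba /asboolP ac; apply/asboolP/(abs_rel_trans ba ac).
Qed.

Canonical abs_equiv X :=
  EquivRel (@abs_eqb X) (@abs_eqb_refl X) (@abs_eqb_sym X) (@abs_eqb_trans X).

Definition abs X : Type := {eq_quot (abs_equiv X)}.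

Definition abs_mk X (v : V) (x : X) : abs X := \pi_{eq_quot (abs_equiv X)} (v, x).

Definition abs_repr X (a : abs X) : V * X := repr (a : {eq_quot (abs_equiv X)}).

Lemma abs_mkP X v w (x y : X) :
  abs_mk v x = abs_mk w y <-> abs_rel (v, x) (w, y).
Proof. by split=> [/eqmodP/asboolP //|h]; apply/eqmodP/asboolP. Qed.

Lemma abs_reprK X (a : abs X) : abs_mk (abs_repr a).1 (abs_repr a).2 = a.
Proof. by rewrite /abs_mk -surjective_pairing; apply: reprK. Qed.

Lemma abs_ind X (P : abs X -> Prop) : (forall v x, P (abs_mk v x)) -> forall a, P a.
Proof. by move=> h a; rewrite -(abs_reprK a). Qed.

Lemma abs_repr_mk X v (x : X) : abs_rel (abs_repr (abs_mk v x)) (v, x).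
Proof.
by move: (abs_reprK (abs_mk v x)) => /abs_mkP; rewrite -surjective_pairing.
Qed.

Definition abs_act X p (a : abs X) : abs X :=
  abs_mk (p (abs_repr a).1) (act p (abs_repr a).2).

Lemma abs_actE X p v (x : X) : abs_act p (abs_mk v x) = abs_mk (p v) (act p x).
Proof.
apply/abs_mkP/abs_rel_act; rewrite -surjective_pairing; exact: abs_repr_mk.
Qed.

Definition nom_abs X : nomSet V.
Proof.
refine (@NomSet V (abs X) (@abs_act X) _ _ _).
- by elim/abs_ind=> v x; rewrite abs_actE act1.
- by move=> p q; elim/abs_ind=> v x; rewrite !abs_actE actM.
elim/abs_ind=> v x; case: (act_fin x) => S fS sS.
exists (v |` S); first by rewrite finite_setU.
by move=> p fp; rewrite abs_actE fp ?sS // => [w Sw|]; [apply: fp; right|left].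
Defined.

Definition abs_map X Y (f : X -> Y) (a : abs X) : abs Y :=
  abs_mk (abs_repr a).1 (f (abs_repr a).2).

Lemma abs_mapE X Y (f : nomHom X Y) v x : abs_map f (abs_mk v x) = abs_mk v (f x).
Proof.
apply/abs_mkP; have := abs_repr_mk v x; case: (abs_repr _) => w y /=.
move=> /abs_rel_any[S fS hS]; apply: (abs_rel_some fS) => z /hS /= e.
by rewrite -!nom_funJ e.
Qed.

Definition Lalpha X : nomSet V := nom_sum (nom_sum nom_var (nom_abs X)) (nom_prod X X).

Definition Lalpha_fun X Y (f : X -> Y) : Lalpha X -> Lalpha Y :=
  sum_map (sum_map id (abs_map f)) (fun u => (f u.1, f u.2)).

Lemma Lalpha_funJ X Y (f : nomHom X Y) p u :
  Lalpha_fun f (act p u) = act p (Lalpha_fun f u).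
Proof.
case: u => [[v|a]|[x y]] //=; last by rewrite !nom_funJ.
by elim/abs_ind: a => v x; rewrite abs_actE !abs_mapE abs_actE nom_funJ.
Qed.

Definition Lalpha_map X Y (f : nomHom X Y) : nomHom (Lalpha X) (Lalpha Y) :=
  NomHom (Lalpha_funJ f).

End NomTheory.

Arguments nom_var : clear implicits.

Record coalg (V : varType) := Coalg {
  coalg_car :> nomSet V;
  coalg_str : nomHom coalg_car (Lalpha coalg_car) }.

Definition is_coalg_hom (V : varType) (C D : coalg V) (h : nomHom C D) :=
  forall x, Lalpha_map h (coalg_str C x) = coalg_str D (h x).

Inductive term (V : Type) :=
| TBot
| TVar of V
| TLam of V & term V
| TApp of term V & term V.

Arguments TBot {V}.

Section Terms.
Context {V : varType}.
Implicit Types (t s r : term V) (p q : fperm V) (x y z v : V).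

Fixpoint tren p t : term V :=
  match t with
  | TBot => TBot
  | TVar v => TVar (p v)
  | TLam x t => TLam (p x) (tren p t)
  | TApp t s => TApp (tren p t) (tren p s)
  end.

(* All variables of a term, including those in binding position. *)
Fixpoint tvars t : seq V :=
  match t with
  | TBot => [::]
  | TVar v => [:: v]
  | TLam x t => x :: tvars t
  | TApp t s => tvars t ++ tvars s
  end.

Fixpoint tfree t : seq V :=
  match t with
  | TBot => [::]
  | TVar v => [:: v]
  | TLam x t => [seq v <- tfree t | v != x]
  | TApp t s => tfree t ++ tfree s
  end.

(* As z does not occur in t and s, swapping replaces x (resp. y) by z
   throughout t (resp. s). *)
Inductive taeq : term V -> term V -> Prop :=
| taeq_bot : taeq TBot TBot
| taeq_var v : taeq (TVar v) (TVar v)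
| taeq_lam x y z t s : z \notin [:: x, y & tvars t ++ tvars s] ->
    taeq (tren (swap x z) t) (tren (swap y z) s) ->
    taeq (TLam x t) (TLam y s)
| taeq_app t t' s s' : taeq t t' -> taeq s s' -> taeq (TApp t s) (TApp t' s').

Lemma trenM p q t : tren (p * q) t = tren p (tren q t).
Proof. by elim: t => [|v|x t /= ->|t /= -> s ->]. Qed.

Lemma tren1 t : tren 1 t = t.
Proof. by elim: t => [|v|x t /= ->|t /= -> s ->]. Qed.

Lemma tvars_ren p t : tvars (tren p t) = map p (tvars t).
Proof. by elim: t => [|v|x t /= ->|t /= -> s ->] //; rewrite map_cat. Qed.

Lemma tren_eq p q t : {in tvars t, p =1 q} -> tren p t = tren q t.
Proof.
elim: t => [|v|x t IH|t IHt s IHs] //= pq.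
- by rewrite pq // inE.
- by rewrite pq ?inE ?eqxx // IH // => v vt; rewrite pq // inE vt orbT.
- by rewrite IHt ?IHs // => v vt; rewrite pq // mem_cat vt ?orbT.
Qed.

Lemma tfree_vars t : {subset tfree t <= tvars t}.
Proof.
elim: t => [|w|x t IH|t IHt s IHs] v //=.
  by rewrite mem_filter inE => /andP[_ /IH ->]; rewrite orbT.
by rewrite !mem_cat => /orP[/IHt ->//|/IHs ->]; rewrite orbT.
Qed.

Lemma fresh_seq (l : seq V) : exists z, z \notin l.
Proof.
have [z nz] : exists z, ~ [set` l] z by apply: fresh_var; exact: finite_seq.
by exists z; apply/negP.
Qed.

Lemma taeq_act p t s : taeq t s -> taeq (tren p t) (tren p s).
Proof.
elim=> /= [|v|x y z t' s' nz _ IH|*]; try by constructor.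
apply: (taeq_lam (z := p z)).
  rewrite !tvars_ren -map_cat -2!map_cons mem_map //; exact: fperm_inj.
by rewrite -!trenM -!swap_conj !trenM.
Qed.

Lemma taeq_refl t : taeq t t.
Proof.
elim: t => [|v|x t IH|t IHt s IHs]; try by constructor.
have [z nz] := fresh_seq [:: x, x & tvars t ++ tvars t].
by apply: taeq_lam nz _; apply: taeq_act.
Qed.

Lemma taeq_sym t s : taeq t s -> taeq s t.
Proof.
elim=> [|v|x y z t' s' nz _ IH|*]; try by constructor.
apply: (taeq_lam (z := z)) => //; apply: contra nz.
rewrite !inE !mem_cat => /or4P[->|->|->|->]; rewrite ?orbT //.
Qed.

Lemma taeq_ren_eq p q t : {in tfree t, p =1 q} -> taeq (tren p t) (tren q t).
Proof.
elim: t p q => [|v|x t IH|t IHt s IHs] p q pq /=; try by constructor.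
- by rewrite pq ?inE //; constructor.
- have [z nz] := fresh_seq [:: p x, q x & tvars (tren p t) ++ tvars (tren q t)].
  apply: (taeq_lam nz); rewrite -!trenM; apply: IH => v vt; rewrite !fpermME.
  case: (eqVneq v x) => [->|vx]; first by rewrite !swapL.
  have pqv : p v = q v by apply: pq; rewrite /= mem_filter vx.
  move: nz; rewrite !inE !mem_cat !negb_or !tvars_ren => /and4P[zp zq nzp nzq].
  have vv : v \in tvars t by apply: tfree_vars.
  rewrite !swapD //.
  + by move=> /fperm_inj; apply/eqP.
  + by move=> e; move/negP: nzq; apply; rewrite -e map_f.
  + by move=> /fperm_inj; apply/eqP.
  + by move=> e; move/negP: nzp; apply; rewrite -e map_f.
- by constructor; [apply: IHt|apply: IHs] => v vt; apply: pq; rewrite /= mem_cat vt ?orbT.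
Qed.

Lemma taeq_lam_inv x y t s : taeq (TLam x t) (TLam y s) ->
  forall u, u \notin [:: x, y & tvars t ++ tvars s] ->
  taeq (tren (swap x u) t) (tren (swap y u) s).
Proof.
move=> h; inversion h as [| |x' y' z t' s' nz ts|]; subst => u nu.
have aux c r : z \notin c :: tvars r -> u \notin c :: tvars r ->
    tren (swap c u) r = tren (swap z u) (tren (swap c z) r).
  rewrite !inE !negb_or => /andP[zc zr] /andP[uc ur]; rewrite -trenM.
  apply: tren_eq => v vr; rewrite fpermME.
  case: (eqVneq v c) => [->|/eqP vc]; first by rewrite !swapL.
  have vz : v <> z by move=> e; rewrite -e vr in zr.
  have vu : v <> u by move=> e; rewrite -e vr in ur.
  by rewrite !(swapD vc, swapD vz).
move: nz nu; rewrite !inE !mem_cat !negb_or => /and4P[zx zy zt zs] /and4P[ux uy ut us].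
rewrite (aux x t) ?(aux y s) ?inE ?negb_or ?zx ?zy ?ux ?uy //.
exact: taeq_act.
Qed.

Fixpoint tsize t : nat :=
  match t with
  | TLam _ t => (tsize t).+1
  | TApp t s => (tsize t + tsize s).+1
  | _ => 0
  end.

Lemma tsize_ren p t : tsize (tren p t) = tsize t.
Proof. by elim: t => [|v|x t /= ->|t /= -> s ->]. Qed.

Lemma taeq_trans t s r : taeq t s -> taeq s r -> taeq t r.
Proof.
have [n] := ubnP (tsize t); elim: n t s r => // n IH t s r tn ts.
case: ts tn => // [x y z t' s' nz ts|t1 t1' t2 t2' ts1 ts2] /= tn sr.
- inversion sr as [| |y' w z' s'' r' nz' sr'|]; subst.
  have [u] := fresh_seq [:: x, y, w & tvars t' ++ tvars s' ++ tvars r'].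
  rewrite !(inE, mem_cat) !negb_or => /and5P[ux uy uw ut /andP[us ur]].
  apply: (taeq_lam (z := u)).
    by rewrite !(inE, mem_cat) !negb_or ux uw ut ur.
  apply: (IH _ (tren (swap y u) s')); first by rewrite tsize_ren.
    apply: (taeq_lam_inv (taeq_lam nz ts)).
    by rewrite !(inE, mem_cat) !negb_or ux uy ut us.
  apply: (taeq_lam_inv sr).
  by rewrite !(inE, mem_cat) !negb_or uy uw us ur.
- inversion sr as [| | |t1'' r1 t2'' r2 sr1 sr2]; subst.
  rewrite ltnS in tn.
  constructor; [apply: IH ts1 sr1|apply: IH ts2 sr2]; apply: leq_trans tn;
    by rewrite ltnS ?leq_addr ?leq_addl.
Qed.

Lemma taeq_lam_free x y u t s : taeq (TLam x t) (TLam y s) ->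
  u \notin tfree (TLam x t) -> u \notin tfree (TLam y s) ->
  taeq (tren (swap x u) t) (tren (swap y u) s).
Proof.
move=> h ut us; have [z] := fresh_seq ([:: x, y, u & tvars t ++ tvars s]).
rewrite !(inE, mem_cat) !negb_or => /and5P[zx zy zu zt zs].
have ts : taeq (tren (swap x z) t) (tren (swap y z) s).
  by apply: taeq_lam_inv h _ _; rewrite !(inE, mem_cat) !negb_or zx zy zt zs.
have aux c r : z \notin c :: tvars r -> u \notin tfree (TLam c r) ->
    taeq (tren (swap c u) r) (tren (swap z u) (tren (swap c z) r)).
  rewrite /= inE negb_or mem_filter => /andP[zc zr] ur; rewrite -trenM.
  apply: taeq_ren_eq => v vr; rewrite fpermME.
  case: (eqVneq v c) => [->|/eqP vc]; first by rewrite !swapL.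
  have vz : v <> z by move=> e; rewrite -e tfree_vars in zr.
  have vu : v <> u.
    by move=> e; move/negP: ur; apply; rewrite -e vr andbT; apply/eqP.
  by rewrite !(swapD vc, swapD vz).
apply: (taeq_trans (aux _ _ _ ut)); first by rewrite inE negb_or zx.
apply: (taeq_trans (taeq_act (swap z u) ts)); apply: taeq_sym.
by apply: aux; rewrite // inE negb_or zy.
Qed.

End Terms.

CoInductive ltree (V : Type) :=
| Var of V
| Lam of V & ltree V
| App of ltree V & ltree V.

Section Trees.
Context {V : varType}.
Implicit Types (t s r : ltree V) (p q : fperm V) (x y z v : V).

CoFixpoint lren p t : ltree V :=
  match t with
  | Var v => Var (p v)
  | Lam x t => Lam (p x) (lren p t)
  | App t s => App (lren p t) (lren p s)
  end.

Inductive free v : ltree V -> Prop :=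
| free_var : free v (Var v)
| free_lam x t : v <> x -> free v t -> free v (Lam x t)
| free_appl t s : free v t -> free v (App t s)
| free_appr t s : free v s -> free v (App t s).

Definition fv t : set V := [set v | free v t].

Fixpoint trunc (n : nat) t : term V :=
  match n, t with
  | 0, _ => TBot
  | _.+1, Var v => TVar v
  | n.+1, Lam x t => TLam x (trunc n t)
  | n.+1, App t s => TApp (trunc n t) (trunc n s)
  end.

Definition aeq t s := forall n, taeq (trunc n t) (trunc n s).

(* Isomorphism of labelled ordered trees, i.e. bisimilarity. *)
CoInductive ltree_iso : ltree V -> ltree V -> Prop :=
| iso_var v : ltree_iso (Var v) (Var v)
| iso_lam x t s : ltree_iso t s -> ltree_iso (Lam x t) (Lam x s)
| iso_app t t' s s' : ltree_iso t t' -> ltree_iso s s' ->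
    ltree_iso (App t s) (App t' s').

Inductive subtree u : ltree V -> Prop :=
| subtree_root : subtree u u
| subtree_lam x t : subtree u t -> subtree u (Lam x t)
| subtree_appl t s : subtree u t -> subtree u (App t s)
| subtree_appr t s : subtree u s -> subtree u (App t s).

Definition rational t :=
  exists2 A : set (ltree V), finite_set A &
    forall u, subtree u t -> exists2 u', A u' & ltree_iso u u'.

Lemma trunc_ren n p t : trunc n (lren p t) = tren p (trunc n t).
Proof. by elim: n t => //= n IH [v|x t|t s] //=; rewrite !IH. Qed.

Lemma tfree_trunc n t v : v \in tfree (trunc n t) -> free v t.
Proof.
elim: n t => //= n IH [w|x t|t s] /=.
- by rewrite inE => /eqP ->; constructor.
- by rewrite mem_filter => /andP[/eqP vx /IH vt]; constructor.
- by rewrite mem_cat => /orP[] /IH vt; [apply: free_appl|apply: free_appr].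
Qed.

Lemma ltree_unfold t :
  t = match t with Var v => Var v | Lam x t => Lam x t | App t s => App t s end.
Proof. by case: t. Qed.

Lemma lren_var p v : lren p (Var v) = Var (p v).
Proof. by rewrite [LHS]ltree_unfold. Qed.
Lemma lren_lam p x t : lren p (Lam x t) = Lam (p x) (lren p t).
Proof. by rewrite [LHS]ltree_unfold. Qed.
Lemma lren_app p t s : lren p (App t s) = App (lren p t) (lren p s).
Proof. by rewrite [LHS]ltree_unfold. Qed.

Lemma free_ren v p t : free v (lren p t) -> free (p^-1 v) t.
Proof.
move er: (lren p t) => r h.
elim: h t er => [|x s nx _ IH|s s' _ IH|s s' _ IH] [w|y t|t t'];
  rewrite ?lren_var ?lren_lam ?lren_app // => -[].
- by move=> <-; rewrite fpermVK; constructor.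
- move=> ey es; constructor; last exact: IH.
  by move=> e; apply: nx; rewrite -ey -e fpermKV.
- by move=> es _; apply: free_appl; apply: IH.
- by move=> _ es; apply: free_appr; apply: IH.
Qed.

Lemma fv_lren_fin p t : finite_set (fv t) -> finite_set (fv (lren p t)).
Proof.
move=> /(finite_image p); apply: sub_finite_set => v /free_ren vt.
by exists (p^-1 v); rewrite ?fpermKV.
Qed.

Lemma fv_lam_fin x t : finite_set (fv (Lam x t)) -> finite_set (fv t).
Proof.
move=> ft; apply: (@sub_finite_set _ _ (x |` fv (Lam x t))).
  by move=> v vt; case: (pselect (v = x)) => vx; [left|right; constructor].
by rewrite finite_setU.
Qed.

Lemma fv_appl_fin t s : finite_set (fv (App t s)) -> finite_set (fv t).
Proof. by apply: sub_finite_set => v; apply: free_appl. Qed.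
Lemma fv_appr_fin t s : finite_set (fv (App t s)) -> finite_set (fv s).
Proof. by apply: sub_finite_set => v; apply: free_appr. Qed.

Lemma aeq_refl t : aeq t t.
Proof. by move=> n; apply: taeq_refl. Qed.
Lemma aeq_sym t s : aeq t s -> aeq s t.
Proof. by move=> ts n; apply: taeq_sym. Qed.
Lemma aeq_trans t s r : aeq t s -> aeq s r -> aeq t r.
Proof. by move=> ts sr n; apply: taeq_trans (ts n) (sr n). Qed.

Lemma aeq_ren p t s : aeq t s -> aeq (lren p t) (lren p s).
Proof. by move=> ts n; rewrite !trunc_ren; apply: taeq_act. Qed.

Lemma aeq_ren_eq p q t : (forall v, free v t -> p v = q v) ->
  aeq (lren p t) (lren q t).
Proof.
move=> pq n; rewrite !trunc_ren; apply: taeq_ren_eq => v /tfree_trunc; exact: pq.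
Qed.

Definition aeqb : rel {classic (ltree V)} := fun t s => `[< aeq t s >].

Lemma aeqb_refl : reflexive aeqb.
Proof. by move=> t; apply/asboolP/aeq_refl. Qed.
Lemma aeqb_sym : symmetric aeqb.
Proof. by move=> t s; apply/asboolP/asboolP; apply: aeq_sym. Qed.
Lemma aeqb_trans : transitive aeqb.
Proof. by move=> s t r /asboolP ts /asboolP sr; apply/asboolP/(aeq_trans ts sr). Qed.

Canonical aeq_equiv := EquivRel aeqb aeqb_refl aeqb_sym aeqb_trans.

Definition aclass : Type := {eq_quot aeq_equiv}.
Definition cls t : aclass := \pi_{eq_quot aeq_equiv} t.

Lemma clsP t s : cls t = cls s <-> aeq t s.
Proof. by split=> [/eqmodP/asboolP //|h]; apply/eqmodP/asboolP. Qed.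

Definition rational_class (q : aclass) := exists2 t, q = cls t & rational t.

Definition nu_sort : Type := {q : aclass | exists2 t, q = cls t & finite_set (fv t)}.

Definition nu_mk t (ft : finite_set (fv t)) : nu_sort :=
  exist _ (cls t) (ex_intro2 _ _ t erefl ft).

Lemma nu_mkP t s (ft : finite_set (fv t)) (fs : finite_set (fv s)) :
  nu_mk ft = nu_mk fs <-> aeq t s.
Proof.
rewrite -clsP; split=> [/(congr1 sval)//|e].
by rewrite /nu_mk; apply: eq_exist.
Qed.

Definition nu_repr (u : nu_sort) : ltree V := s2val (cid2 (svalP u)).

Lemma nu_repr_fin u : finite_set (fv (nu_repr u)).
Proof. by rewrite /nu_repr; case: cid2. Qed.

Lemma nu_reprK u : nu_mk (nu_repr_fin u) = u.
Proof.
case: u => q Pq; rewrite /nu_mk; apply: eq_exist.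
by rewrite /nu_repr; case: cid2 => t /= ->.
Qed.

Lemma nu_ind (P : nu_sort -> Prop) :
  (forall t (ft : finite_set (fv t)), P (nu_mk ft)) -> forall u, P u.
Proof. by move=> h u; rewrite -(nu_reprK u). Qed.

Lemma nu_repr_mk t (ft : finite_set (fv t)) : aeq (nu_repr (nu_mk ft)) t.
Proof. by apply/(nu_mkP (nu_repr_fin _) ft)/nu_reprK. Qed.

Definition nu_act p u : nu_sort := nu_mk (fv_lren_fin p (nu_repr_fin u)).

Lemma nu_actE p t (ft : finite_set (fv t)) :
  nu_act p (nu_mk ft) = nu_mk (fv_lren_fin p ft).
Proof. by apply/nu_mkP/aeq_ren/nu_repr_mk. Qed.

Definition nom_nu : nomSet V.
Proof.
refine (@NomSet V nu_sort nu_act _ _ _).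
- elim/nu_ind=> t ft; rewrite nu_actE; apply/nu_mkP => n.
  by rewrite trunc_ren tren1; apply: taeq_refl.
- move=> p q; elim/nu_ind=> t ft; rewrite !nu_actE; apply/nu_mkP => n.
  by rewrite !trunc_ren trenM; apply: taeq_refl.
elim/nu_ind=> t ft; exists (fv t) => // p fp; rewrite nu_actE; apply/nu_mkP.
apply: (aeq_trans (aeq_ren_eq (q := 1) _)); first by move=> v vt; rewrite fp.
by move=> n; rewrite trunc_ren tren1; apply: taeq_refl.
Defined.

Definition nu_dec t : finite_set (fv t) -> Lalpha nom_nu :=
  match t with
  | Var v => fun _ => inl (inl v)
  | Lam x t => fun ft =>
      inl (inr (abs_mk x (nu_mk (fv_lam_fin ft) : nom_nu)))
  | App t s => fun ft => inr (nu_mk (fv_appl_fin ft), nu_mk (fv_appr_fin ft))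
  end.

Lemma nu_dec_aeq t s (ft : finite_set (fv t)) (fs : finite_set (fv s)) :
  aeq t s -> nu_dec ft = nu_dec fs.
Proof.
case: t s ft fs => [v|x t|t t'] [w|y s|s s'] ft fs ts;
  have h1 := ts 1%N; inversion h1; subst => //=.
- congr (inl (inr _)); apply/abs_mkP.
  apply: (@abs_rel_some _ _ _ _ (fv (Lam x t) `|` fv (Lam y s))).
    by rewrite finite_setU.
  move=> u nu /=; rewrite !nu_actE; apply/nu_mkP => n; rewrite !trunc_ren.
  have h := ts n.+1.
  apply: taeq_lam_free h _ _; apply/negP => us; apply: nu.
    by left; apply: (@tfree_trunc n.+1).
  by right; apply: (@tfree_trunc n.+1).
- congr (inr (_, _)); apply/nu_mkP => n; have := ts n.+1 => h;
    by inversion h.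
Qed.

Definition nu_str_fun (u : nom_nu) : Lalpha nom_nu := nu_dec (nu_repr_fin u).

Lemma nu_strE t (ft : finite_set (fv t)) : nu_str_fun (nu_mk ft) = nu_dec ft.
Proof. exact/nu_dec_aeq/nu_repr_mk. Qed.

Lemma nu_strJ p u : nu_str_fun (act p u) = act p (nu_str_fun u).
Proof.
elim/nu_ind: u => t ft; rewrite /= nu_actE !nu_strE.
move: (fv_lren_fin p ft); case: t ft => [v|x t|t s] ft.
- by rewrite lren_var.
- rewrite lren_lam => fpt; rewrite /= abs_actE.
  congr (inl (inr (abs_mk _ _))); rewrite /= nu_actE.
  by apply/nu_mkP/aeq_refl.
- rewrite lren_app => fpt /=; rewrite !nu_actE.
  by congr (inr (_, _)); apply/nu_mkP/aeq_refl.
Qed.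

Definition nu_str : nomHom nom_nu (Lalpha nom_nu) := NomHom nu_strJ.

End Trees.

Arguments aclass : clear implicits.

Definition nuL (V : varType) : coalg V := Coalg (@nu_str V).

Section Finality.
Context {V : varType} (C : coalg V).
Implicit Types (a b : C) (p q : fperm V).

CoFixpoint unfold a : ltree V :=
  match coalg_str C a with
  | inl (inl v) => Var v
  | inl (inr b) => Lam (abs_repr b).1 (unfold (abs_repr b).2)
  | inr (b1, b2) => App (unfold b1) (unfold b2)
  end.

Lemma unfoldE a : unfold a =
  match coalg_str C a with
  | inl (inl v) => Var v
  | inl (inr b) => Lam (abs_repr b).1 (unfold (abs_repr b).2)
  | inr (b1, b2) => App (unfold b1) (unfold b2)
  end.
Proof.
by rewrite [LHS]ltree_unfold /=; case: (nom_fun _ _) => [[v|b]|[b1 b2]].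
Qed.

Lemma supports_var (S : set V) (v : nom_var V) :
  finite_set S -> supports S v -> S v.
Proof.
move=> fS sS; apply: contrapT => nS.
have [w nw] : exists w, ~ (v |` S) w by apply: fresh_var; rewrite finite_setU.
have wv : act (swap (v : V) w) v = v.
  apply: sS => r Sr; apply: swapD => e; first by apply: nS; rewrite -e.
  by apply: nw; right; rewrite -e.
by apply: nw; left; exact: etrans (esym (swapL (v : V) w)) wv.
Qed.

Lemma supports_abs (X : nomSet V) (S : set V) (w : V) (x : X) :
  supports S (abs_mk w x : nom_abs X) -> supports (w |` S) x.
Proof.
move=> sS p fp; have /= : act p (abs_mk w x : nom_abs X) = abs_mk w x.
  by apply: sS => v Sv; apply: fp; right.
rewrite abs_actE fp; last by left.
by move=> /abs_mkP[z [/= _ _ _]]; apply: act_inj.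
Qed.

Lemma free_unfold v a (S : set V) : finite_set S -> supports S a ->
  free v (unfold a) -> S v.
Proof.
move=> + + h; move et: (unfold a) h => t h.
elim: h a et S => {t} [|x t vx _ IH|t s _ IH|t s _ IH] a et S fS
  /(hom_supports (coalg_str C)) sS; move: et sS; rewrite unfoldE;
  case: (nom_fun _ _) => [[w|b]|[b1 b2]] //.
- move=> -[->] sS; apply: supports_var => // p fp.
  by have := sS p fp => -[].
- move=> -[ex et] sS; have : (x |` S) v; last by case.
  apply: (IH (abs_repr b).2) => //; first by rewrite finite_setU.
  apply: supports_abs => p fp; rewrite -ex abs_reprK.
  by have := sS p fp => -[].
- move=> -[et _] sS; apply: (IH b1) => // p fp.
  by have := sS p fp => -[].
- move=> -[_ et] sS; apply: (IH b2) => // p fp.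
  by have := sS p fp => -[].
Qed.

Lemma unfold_fin a : finite_set (fv (unfold a)).
Proof.
case: (act_fin a) => S fS sS; apply: (@sub_finite_set _ _ S) => // v vt.
exact: free_unfold vt.
Qed.

Lemma unfoldJ p a : aeq (unfold (act p a)) (lren p (unfold a)).
Proof.
move=> n; elim: n p a => [|n IH] p a; first by constructor.
rewrite trunc_ren !unfoldE nom_funJ.
case: (nom_fun _ _) => [[v|b]|[b1 b2]] /=; try by constructor.
- set r := abs_repr (abs_act p b); set b' := abs_repr b.
  have : abs_rel r (p b'.1, act p b'.2).
    by rewrite /r; apply: abs_repr_mk.
  move=> /abs_rel_any[S fS hS].
  pose l := [:: r.1, p b'.1 & tvars (trunc n (unfold r.2)) ++
               tvars (tren p (trunc n (unfold b'.2)))].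
  have [z nz] : exists z, ~ (S `|` [set` l]) z.
    by apply: fresh_var; rewrite finite_setU; split=> //; apply: finite_seq.
  apply: (taeq_lam (z := z)); first by apply/negP => zl; apply: nz; right.
  have /hS /= e : ~ S z by move=> Sz; apply: nz; left.
  have := IH (swap r.1 z) r.2; rewrite trunc_ren => /taeq_sym h1.
  apply: taeq_trans h1 _; rewrite e -actM -trenM -trunc_ren; exact: IH.
- by rewrite -!trunc_ren; constructor; apply: IH.
Qed.

Definition unfold_nu a : nuL V := nu_mk (unfold_fin a).

Lemma unfold_nuJ p a : unfold_nu (act p a) = act p (unfold_nu a).
Proof. by rewrite /= nu_actE; apply/nu_mkP/unfoldJ. Qed.

Definition unfold_hom : nomHom C (nuL V) := NomHom unfold_nuJ.

Lemma unfold_is_hom : is_coalg_hom unfold_hom.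
Proof.
move=> a; apply: etrans (esym (nu_strE (unfold_fin a))); move: (unfold_fin a); rewrite unfoldE.
case: (coalg_str C a) => [[v|b]|[b1 b2]] ft //=.
- rewrite -[in LHS](abs_reprK b) (abs_mapE unfold_hom).
  congr (inl (inr (abs_mk _ _))); exact/nu_mkP/aeq_refl.
- by congr (inr (_, _)); apply/nu_mkP/aeq_refl.
Qed.

Lemma hom_aeq (h k : nomHom C (nuL V)) : is_coalg_hom h -> is_coalg_hom k ->
  forall n a t s (ft : finite_set (fv t)) (fs : finite_set (fv s)),
  h a = nu_mk ft -> k a = nu_mk fs -> taeq (trunc n t) (trunc n s).
Proof.
move=> hh hk; elim=> [|n IH] a t s ft fs ha ka; first by constructor.
have := hh a; have := hk a; rewrite ha ka /= !nu_strE.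
case: (nom_fun _ _) => [[v|b]|[b1 b2]] /=.
- by case: s fs {ka} => //= _ _ [<-]; case: t ft {ha} => //= _ _ [<-]; constructor.
- rewrite -(abs_reprK b) (abs_mapE h) (abs_mapE k).
  case: (abs_repr b) => v x /=.
  case: s fs {ka} => // y s fs [/abs_mkP/abs_rel_any[S fS hS]].
  case: t ft {ha} => // y' t ft [/abs_mkP/abs_rel_any[T fT hT]] /=.
  pose l := [:: y', y & tvars (trunc n t) ++ tvars (trunc n s)].
  have [z nz] : exists z, ~ (S `|` T `|` [set` l]) z.
    by apply: fresh_var; rewrite !finite_setU; split=> //; apply: finite_seq.
  apply: (taeq_lam (z := z)); first by apply/negP => zl; apply: nz; right.
  have /hS /= : ~ S z by move=> ?; apply: nz; left; left.
  have /hT /= : ~ T z by move=> ?; apply: nz; left; right.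
  rewrite !nu_actE => et es; rewrite -!trunc_ren.
  exact: (IH _ _ _ _ _ (etrans (nom_funJ h _ _) et) (etrans (nom_funJ k _ _) es)).
- case: s fs {ka} => // s1 s2 fs [e1 e2]; case: t ft {ha} => // t1 t2 ft [d1 d2] /=.
  by constructor; [exact: (IH _ _ _ _ _ d1 e1)|exact: (IH _ _ _ _ _ d2 e2)].
Qed.

Theorem nu_final : exists! h : nomHom C (nuL V), is_coalg_hom h.
Proof.
exists unfold_hom; split=> [|k hk]; first exact: unfold_is_hom.
apply: nomHom_ext => a; rewrite -(nu_reprK (unfold_hom a)) -(nu_reprK (k a)).
apply/nu_mkP => n.
apply: (@hom_aeq _ _ unfold_is_hom hk n a _ _ (nu_repr_fin _) (nu_repr_fin _));
  exact/esym/nu_reprK.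
Qed.

Definition dagger : nomHom C (nuL V) := sval (cid nu_final).

Lemma daggerP : is_coalg_hom dagger.
Proof. by case: (svalP (cid nu_final)). Qed.

Lemma dagger_uniq (h : nomHom C (nuL V)) : is_coalg_hom h -> dagger = h.
Proof. by case: (svalP (cid nu_final)) => _; apply. Qed.

End Finality.

(* The colimit of all coalgebras with orbit-finite carrier, as the union of
   their images in the final coalgebra. *)
Definition rational_fixpoint (V : varType) : set (nuL V) :=
  [set u | exists C : coalg V, orbit_finite C /\ range (dagger C) u].

Arguments rational_fixpoint : clear implicits.

(* Main.v *)
Require Import Defs.
From mathcomp Require Import all_boot.
From mathcomp Require Import boolp classical_sets functions cardinality.
(* Makes orbit denote the orbit of an element of a nominal set again, instead of
   the orbit of a function from fingraph. *)
Import Defs.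

(** The two inclusions are proved by different finiteness arguments.

    From orbit-finite coalgebras to rational trees.  The unique homomorphism
    from a coalgebra C to the final one sends a state a to the class of the
    tree obtained by unfolding a, where at each abstraction <v>y a concrete
    representative (v, y) has to be picked.  The class of the tree does not
    depend on these picks ([unfold_along_aeq]), but its number of subtrees
    does.  If C is orbit-finite, then every state has a support of size at most
    some fixed m ([orbit_finite_supports_bound]).  Fix a set W of more than m
    variables that supports a.  For a state x supported by W with structure
    <v>y, some w in W lies outside a small support of x, so it can serve as
    bound variable: <v>y = <w>y' ([abs_mk_rename]), and then y' is again
    supported by W.  Hence the unfolding of a only visits states supported by
    W, of which there are finitely many ([orbit_finite_supported]), and the
    resulting tree is rational ([unfold_rational]).

    From rational trees to orbit-finite coalgebras.  A rational tree t has
    finitely many free variables.  The classes of its subtrees, closed under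
    renaming, form a subset of the final coalgebra that is closed under
    decomposition at the root, hence carry a coalgebra structure
    ([coalg_of_mono]); by finality the inclusion is the unique homomorphism.
    Each orbit contains the class of a subtree, so rationality of t makes this
    subcoalgebra orbit-finite ([rational_rational_fixpoint]). *)


Set Implicit Arguments.
Unset Strict Implicit.
Unset Printing Implicit Defensive.

Local Open Scope classical_set_scope.
Local Open Scope group_scope.

(** * Supports in orbit-finite nominal sets *)

Section OrbitFinite.
Context {V : varType} (X : nomSet V).
Implicit Types (x y : X) (W l : seq V).

Lemma orbit_refl x : orbit x x.
Proof. by exists 1 => //; rewrite act1. Qed.

Lemma supports_seq x : exists l, supports [set` l] x.
Proof.
case: (act_fin x) => S /finite_seqP[l ->] sl; by exists l.
Qed.

(** Renaming turns a support of x into a support of act p x of the same size, so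
    one bound serves a whole orbit. *)
Lemma orbit_finite_supports_bound : orbit_finite X ->
  exists m, forall x, exists2 l, size l <= m & supports [set` l] x.
Proof.
have bound (O : set X) : exists m, forall x, O = orbit x ->
    exists2 l, size l <= m & supports [set` l] x.
  case: (pselect (exists x, O = orbit x)) => [[x ->]|nO]; last first.
    by exists 0 => x Ox; case: nO; exists x.
  have [l sl] := supports_seq x; exists (size l) => y xy.
  have [p _ <-] : orbit x y by rewrite xy; apply: orbit_refl.
  exists (map p l); rewrite ?size_map //.
  apply: supportsS (supports_act (p := p) sl) => _ [v vl <-].
  exact: map_f.
have [g gP] := choice bound.
move=> /finite_seqP[s sE]; exists (\max_(O <- s) g O) => x.
have [l lg sl] := gP _ x erefl; exists l => //; apply: leq_trans lg _.
apply: leq_bigmax_seq => //.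
have : range (@orbit V X) (orbit x) by exists x.
by rewrite sE.
Qed.

(** Within the orbit of x, an element act p x is determined by the values of p on
    the support of x, and these values lie in W as soon as W supports act p x:
    there are at most as many such elements as maps from supp x to W. *)
Lemma orbit_finite_supported W : orbit_finite X ->
  finite_set [set x : X | supports [set` W] x].
Proof.
move=> oX.
suff fO x : finite_set [set y | orbit x y /\ supports [set` W] y].
  apply: sub_finite_set (bigcup_finite (F := fun O =>
    [set y | O y /\ supports [set` W] y]) oX _) => [y sy|_ [x _ <-]]; last exact: fO.
  by exists (orbit y) => //; split=> //; apply: orbit_refl.
have [fS sS Smin] := supp_least x.
move: fS => /finite_seqP[s sE].
pose val_map (l : (size s).-tuple (seq_sub W)) : seq V := map val l.
(* A list of values is sent to the element act p x for any p taking these values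
   on supp x, and to a junk value when there is no such p. *)
have pickP (l : (size s).-tuple (seq_sub W)) :
    exists y : X, forall p : fperm V, map p s = val_map l -> act p x = y.
  case: (pselect (exists p : fperm V, map p s = val_map l)) => [[p pl]|np].
    exists (act p x) => q ql; apply: (supports_eq sS) => v; rewrite sE => vs.
    by move: v vs; apply/eq_in_map; rewrite pl.
  by exists x => p pl; case: np; exists p.
have [f fP] := choice pickP.
apply: sub_finite_set (finite_image f (@finite_finset _ setT)).
move=> _ [[p _ <-] sW].
(* Since W supports act p x, its preimage under p supports x, and so contains
   the least support of x. *)
have pW v : v \in s -> p v \in W.
  move=> vs; have : supp x v by rewrite sE.
  move=> /(Smin [set p^-1 w | w in [set` W]]); case.
  - by apply: finite_image; apply: finite_seq.
  - by rewrite -(actK p x); apply: supports_act.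
  - by move=> w wW <-; rewrite fpermKV.
have [t tE] : exists t : seq (seq_sub W), map val t = map p s.
  elim: s pW {sE val_map pickP f fP} => [|v s IH] pW; first by exists [::].
  have [t tE] : exists t : seq (seq_sub W), map val t = map p s.
    by apply: IH => u us; apply: pW; rewrite inE us orbT.
  have vW : p v \in W by apply: pW; rewrite inE eqxx.
  by exists (SeqSub vW :: t); rewrite /= tE.
have st : size t == size s by rewrite -(size_map val) tE size_map.
exists (Tuple st) => //; apply/esym/fP; exact/esym.
Qed.

End OrbitFinite.

(** * Choice of the bound variable *)

Section AbsRepresentative.
Context {V : varType} (X : nomSet V).
Implicit Types (x y : X) (b : abs X) (v w : V).

(** If b = <v>x, a variable w outside a finite support of b is either v itself or
    fresh for x; in both cases b = <w>((v w) x). *)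
Lemma abs_mk_rename b w (S : set V) : finite_set S ->
  supports S (b : nom_abs X) -> ~ S w ->
  exists y, abs_mk w y = b.
Proof.
move=> fS; elim/(@abs_ind V X): b => v x sS nw.
case: (pselect (w = v)) => [->|wv]; first by exists x.
exists (act (swap v w) x); have sx := supports_abs sS.
apply/abs_mkP/(@abs_rel_some _ _ _ _ S) => // z nz /=.
rewrite -actM; apply: (supports_eq sx) => r rS; rewrite fpermME.
case: (pselect (r = v)) => [->|rv]; first by rewrite !swapL.
have Sr : S r by case: rS.
have rw : r <> w by move=> e; apply: nw; rewrite -e.
have rz : r <> z by move=> e; apply: nz; rewrite -e.
by rewrite (swapD rv rw) (swapD rw rz) (swapD rv rz).
Qed.

End AbsRepresentative.

(** * Unfolding along a choice of representatives *)

Section UnfoldAlong.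
Context {V : varType} {C : coalg V}.
Variable rep : abs C -> V * C.
Hypothesis repK : forall b, abs_mk (rep b).1 (rep b).2 = b.
Implicit Types a : C.

CoFixpoint unfold_along a : ltree V :=
  match coalg_str C a with
  | inl (inl v) => Var v
  | inl (inr b) => Lam (rep b).1 (unfold_along (rep b).2)
  | inr (b1, b2) => App (unfold_along b1) (unfold_along b2)
  end.

Lemma unfold_alongE a : unfold_along a =
  match coalg_str C a with
  | inl (inl v) => Var v
  | inl (inr b) => Lam (rep b).1 (unfold_along (rep b).2)
  | inr (b1, b2) => App (unfold_along b1) (unfold_along b2)
  end.
Proof.
by rewrite [LHS]ltree_unfold /=; case: (nom_fun _ _) => [[v|b]|[b1 b2]].
Qed.

(** The states y and x behind two representatives (w, y) and (v, x) of one
    abstraction become equal once w and v are swapped with a fresh z, and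
    unfolding commutes with swapping up to alpha-equivalence. *)
Lemma unfold_along_aeq a : aeq (unfold_along a) (unfold a).
Proof.
move=> n; elim: n a => [|n IH] a; first by constructor.
rewrite unfold_alongE unfoldE.
case: (nom_fun _ _) => [[v|b]|[b1 b2]] /=; try by constructor.
have /abs_mkP/abs_rel_any[S fS] := etrans (repK b) (esym (abs_reprK b)).
case: (rep b) (abs_repr b) => [w y] [v x] /= hS.
pose l := [:: w, v & tvars (trunc n (unfold_along y)) ++
             tvars (trunc n (unfold x))].
have [z nz] : exists z, ~ (S `|` [set` l]) z.
  by apply: fresh_var; rewrite finite_setU; split=> //; apply: finite_seq.
apply: (taeq_lam (z := z)); first by apply/negP => zl; apply: nz; right.
have /hS e : ~ S z by move=> Sz; apply: nz; left.
apply: taeq_trans (taeq_act _ (IH y)) _.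
have := unfoldJ (swap w z) y n; rewrite trunc_ren => /taeq_sym h.
by apply: taeq_trans h _; rewrite e -trunc_ren; apply: unfoldJ.
Qed.

(** If D is closed under the chosen successors, every subtree of the unfolding of
    a state of D is itself the unfolding of a state of D. *)
Lemma unfold_along_rational (D : set C) a : finite_set D -> D a ->
  (forall x y, D x -> match coalg_str C x with
     | inl (inl _) => False
     | inl (inr b) => y = (rep b).2
     | inr (b1, b2) => y = b1 \/ y = b2
     end -> D y) ->
  rational (unfold_along a).
Proof.
move=> fD Da step; exists (unfold_along @` D); first exact: finite_image.
have iso_refl : forall t : ltree V, ltree_iso t t.
  by cofix IH => -[v|x t|t s]; constructor; apply: IH.
move=> u; move et: (unfold_along a) => t ut; exists u => //.
elim: ut a Da et => {t} [|x t _ IH|t s _ IH|t s _ IH] a Da;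
  first (by exists a); rewrite unfold_alongE; have := step a ^~ Da;
  case: (nom_fun _ _) => [[v|b]|[b1 b2]] // Dstep.
- by case=> _; apply: IH; apply: Dstep.
- by case=> et _; apply: IH et; apply: Dstep; left.
- by case=> _; apply: IH; apply: Dstep; right.
Qed.

End UnfoldAlong.

(** * Unfoldings in orbit-finite coalgebras *)

Section RationalUnfolding.
Context {V : varType}.

Lemma extend_seq (l : seq V) m :
  exists W, [/\ uniq W, {subset l <= W} & m < size W].
Proof.
elim: m => [|m [W [uW lW mW]]].
  have [z zl] := fresh_seq l; exists (z :: undup l); split=> //=.
    by rewrite mem_undup zl undup_uniq.
  by move=> v vl; rewrite inE mem_undup vl orbT.
have [z zW] := fresh_seq W; exists (z :: W); split=> //=; first by rewrite zW.
by move=> v /lW vW; rewrite inE vW orbT.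
Qed.

(** The invariant along the unfolding is that states are supported by W.  It can
    be kept because the abstraction met at such a state also has a support of
    size at most m: this support need not lie in W, but as W is larger, it
    leaves a variable of W available for the binder. *)
Lemma unfold_rational (C : coalg V) (a : C) : orbit_finite C ->
  exists2 t, aeq t (unfold a) & rational t.
Proof.
move=> oC; have [m mP] := orbit_finite_supports_bound oC.
have [l0 sl0] := supports_seq a; have [W [uW lW mW]] := extend_seq l0 m.
have repP (b : abs C) : exists r : V * C, abs_mk r.1 r.2 = b /\
    (supports [set` W] (b : nom_abs C) ->
     (exists2 l, size l <= m & supports [set` l] (b : nom_abs C)) ->
     supports [set` W] r.2).
  case: (pselect (supports [set` W] (b : nom_abs C) /\
     exists2 l, size l <= m & supports [set` l] (b : nom_abs C)));
    last first.
    by move=> nb; exists (abs_repr b); split=> [|sW sl]; [exact: abs_reprK|case: nb].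
  move=> [sW [l lm sl]].
  have [w wW wl] : exists2 w, w \in W & w \notin l.
    apply: contrapT => nw; have : size W <= size l.
      apply: uniq_leq_size => // w wW; apply: contrapT => /negP wl.
      by apply: nw; exists w.
    by move=> Wl; have := leq_trans mW (leq_trans Wl lm); rewrite ltnn.
  have [y yE] := abs_mk_rename (finite_seq l) sl (elimN idP wl).
  exists (w, y); split=> // _ _ /=; rewrite -yE in sW.
  by apply: supportsS (supports_abs sW) => v [->|].
have [rep repE] := choice repP.
exists (unfold_along rep a).
  by apply: unfold_along_aeq => b; case: (repE b).
apply: (@unfold_along_rational _ _ _ [set x : C | supports [set` W] x]).
- exact: orbit_finite_supported.
- exact: supportsS sl0.
move=> x y /(hom_supports (coalg_str C)).
have [l lm /(hom_supports (coalg_str C))] := mP x.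
case: (nom_fun _ _) => [[v|b]|[b1 b2]] // sl sW.
- move=> ->; case: (repE b) => _; apply.
    by move=> p fp; have := sW p fp => -[].
  by exists l => // p fp; have := sl p fp => -[].
- by case=> -> p fp; have := sW p fp => -[].
Qed.

End RationalUnfolding.

(** * Subcoalgebras *)

Section Subcoalgebra.
Context {V : varType}.

Lemma abs_map_inj (X Y : nomSet V) (f : nomHom X Y) :
  injective f -> injective (abs_map f).
Proof.
move=> fI; elim/(@abs_ind V X)=> v x; elim/(@abs_ind V X)=> w y; rewrite !abs_mapE.
move=> /abs_mkP/abs_rel_any[S fS hS]; apply/abs_mkP/(abs_rel_some fS) => z /hS /=.
by rewrite -!nom_funJ => /fI.
Qed.

Lemma Lalpha_map_inj (X Y : nomSet V) (f : nomHom X Y) :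
  injective f -> injective (Lalpha_map f).
Proof.
move=> fI [[v|a]|[x y]] [[w|b]|[x' y']] //=.
- by case=> ->.
- by case=> /(abs_map_inj fI) ->.
- by case=> /fI -> /fI ->.
Qed.

Definition sub_nom (X : nomSet V) (P : set X)
  (PJ : forall p x, P x -> P (act p x)) : nomSet V.
Proof.
refine (@NomSet V {x | P x} (fun p x => exist _ (act p (sval x)) (PJ p _ (svalP x))) _ _ _).
- by case=> x Px; apply: eq_exist; rewrite /= act1.
- by move=> p q [x Px]; apply: eq_exist; rewrite /= actM.
by case=> x Px; case: (act_fin x) => S fS sS; exists S => // p fp;
  apply: eq_exist; apply: sS.
Defined.

Definition sub_incl (X : nomSet V) (P : set X)
  (PJ : forall p x, P x -> P (act p x)) : nomHom (sub_nom PJ) X :=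
  @NomHom V (sub_nom PJ) X sval (fun _ _ => erefl).

Lemma sub_incl_inj (X : nomSet V) (P : set X)
  (PJ : forall p x, P x -> P (act p x)) : injective (sub_incl PJ).
Proof. by case=> x Px [y Py] /= e; apply: eq_exist. Qed.

(** The functor preserves injectivity, so the lifted structure is determined
    pointwise, and its equivariance follows from that of the structure of D. *)
Lemma coalg_of_mono (D : coalg V) (X : nomSet V) (i : nomHom X D) :
  injective i -> (forall x, range (Lalpha_map i) (coalg_str D (i x))) ->
  exists c : nomHom X (Lalpha X), @is_coalg_hom V (Coalg c) D i.
Proof.
move=> /Lalpha_map_inj iI h.
have /choice[c cE] : forall x, exists y, Lalpha_map i y = coalg_str D (i x).
  by move=> x; have [y _ yE] := h x; exists y.
suff cJ p x : c (act p x) = act p (c x) by exists (NomHom cJ).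
by apply: iI; rewrite nom_funJ !cE !nom_funJ.
Qed.

End Subcoalgebra.

(** * Rational trees in the final coalgebra *)

Section RationalTree.
Context {V : varType}.
Implicit Types t s u : ltree V.

Lemma ltree_iso_trunc t s n : ltree_iso t s -> trunc n t = trunc n s.
Proof.
elim: n t s => //= n IH t s; case=> //= [x|] t1 t2.
  by move=> /IH ->.
by move=> s1 s2 /IH -> /IH ->.
Qed.

Lemma ltree_iso_aeq t s : ltree_iso t s -> aeq t s.
Proof. by move=> ts n; rewrite (ltree_iso_trunc n ts); apply: taeq_refl. Qed.

Lemma nu_sval_inj : injective (fun w : nuL V => sval w).
Proof. by case=> q Pq [r Pr] /= e; apply: eq_exist. Qed.

Lemma subtree_trans u s t : subtree u s -> subtree s t -> subtree u t.
Proof.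
move=> us; elim=> // *; [exact: subtree_lam|exact: subtree_appl|exact: subtree_appr].
Qed.

Lemma free_subtree v t : free v t -> subtree (Var v) t.
Proof.
elim=> *; [exact: subtree_root|exact: subtree_lam|exact: subtree_appl|exact: subtree_appr].
Qed.

(** A free variable of t labels a leaf of t, and leaves with different
    labels are not isomorphic. *)
Lemma rational_fv t : rational t -> finite_set (fv t).
Proof.
move=> [A fA hA].
apply: (@sub_finite_set _ _ (@Var V @^-1` A)).
  move=> v /free_subtree/hA[u' Au' iu]; inversion iu; subst; exact: Au'.
by apply: finite_preimage => // v w _ _ [].
Qed.

(** The coalgebra containing the class of t consists of all renamings of classes
    of subtrees of t. *)
Lemma rational_rational_fixpoint t (ft : finite_set (fv t)) :
  rational t -> rational_fixpoint V (nu_mk ft).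
Proof.
move=> rt.
pose P : set (nuL V) := [set u : nuL V | exists p s (fs : finite_set (fv s)),
  subtree s t /\ u = act p (nu_mk fs : nuL V)].
have PJ q (u : nuL V) : P u -> P (act q u).
  move=> [p [s [fs [st ->]]]]; exists (q * p), s, fs; split=> //.
  exact: esym (actM _ _ _).
have Psub s (fs : finite_set (fv s)) : subtree s t -> P (nu_mk fs).
  by move=> st; exists 1, s, fs; rewrite act1.
(* By equivariance it is enough to decompose the subtrees themselves. *)
have dec_in s (fs : finite_set (fv s)) : subtree s t ->
    range (Lalpha_map (sub_incl PJ)) (nu_dec fs).
  case: s fs => [v|x s|s1 s2] fs st.
  - by exists (inl (inl v)).
  - have Ps : P (nu_mk (fv_lam_fin fs)).
      by apply/Psub/(subtree_trans _ st)/subtree_lam/subtree_root.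
    exists (inl (inr (abs_mk x (exist P _ Ps : sub_nom PJ)))) => //.
    by rewrite /= (abs_mapE (sub_incl PJ)).
  - have P1 : P (nu_mk (fv_appl_fin fs)).
      by apply/Psub/(subtree_trans _ st)/subtree_appl/subtree_root.
    have P2 : P (nu_mk (fv_appr_fin fs)).
      by apply/Psub/(subtree_trans _ st)/subtree_appr/subtree_root.
    by exists (inr (exist P _ P1 : sub_nom PJ, exist P _ P2 : sub_nom PJ)).
have [|c chom] := coalg_of_mono (D := nuL V) (@sub_incl_inj V _ _ PJ).
  move=> [u Pu] /=; case: Pu => p [s [fs [st ->]]]; have [y _ yE] := dec_in s fs st.
  exists (act p y) => //.
  apply: etrans (nom_funJ (Lalpha_map (sub_incl PJ)) p y) _.
  rewrite yE -(nu_strE fs).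
  by exact: esym (nu_strJ p (nu_mk fs)).
exists (Coalg c); split; last first.
  have Pt : P (nu_mk ft) by apply/Psub/subtree_root.
  by rewrite (dagger_uniq chom); exists (exist P _ Pt).
case: (rt) => A fA hA.
(* Isomorphic subtrees have the same class, so every orbit is that of the class
   of some tree in the finite set A. *)
pose orb (u : ltree V) := [set x : sub_nom PJ | exists p,
  sval (sval x) = cls (lren p u)].
apply: sub_finite_set (finite_image orb fA).
move=> _ [[x Px] _ <-]; have [p [s [fs [st xE]]]] := Px.
have [u Au /ltree_iso_aeq su] := hA s st; exists u => //.
have clsE q : cls (lren q u) = sval (act q (nu_mk fs : nuL V)).
  apply: etrans (esym (congr1 sval (nu_actE q fs))).
  by apply/esym/clsP/aeq_ren.
apply/seteqP; split=> [[y Py] /= [q]|_ [q _ <-] /=]; last first.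
  exists (q * p); rewrite clsE (actM (n := nuL V)).
  by rewrite -xE.
rewrite clsE => yE; exists (q * p^-1) => //; apply: eq_exist.
rewrite -[sval _]/x xE -(actM (n := nuL V)) -mulgA mulVg mulg1.
exact/nu_sval_inj/esym.
Qed.

End RationalTree.

Theorem theorem3p4 (V : varType) :
  (forall u : nuL V, rational_fixpoint V u <-> rational_class (sval u)) /\
  (forall q : aclass V, rational_class q -> exists2 u : nuL V, sval u = q & rational_fixpoint V u).
Proof.
have rat q : rational_class q -> exists2 u : nuL V, sval u = q & rational_fixpoint V u.
  move=> [t -> rt]; exists (nu_mk (rational_fv rt)) => //.
  exact: rational_rational_fixpoint.
split=> // u; split=> [[C [oC [a _ <-]]]|/rat[w wu rw]].
  have [t ta rt] := unfold_rational a oC; exists t => //.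
  by rewrite (dagger_uniq (unfold_is_hom (C := C))); apply/clsP/aeq_sym.
by by rewrite -(nu_sval_inj wu).
Qed.
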